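(* A moving energy of a nonholonomic system with affine constraints $(L,Q,\mathcal{M}=Z+\mathcal{D})$ is kinematically interpretable if and only if it has a generator $Y$ that satisfies the following three conditions: (P1) $Y-Z\in\Gamma(\mathcal{D})$. (P2) $\mathcal{D}$ is $Y$-invariant, namely $\mathcal{D}_{\Phi^Y_t(q)}=(\Phi^Y_t)'(q)\,\mathcal{D}_q$ for all $t\in\mathbb{R}$, $q\in Q$, where $\Phi^Y:\mathbb{R}\times Q\to Q$ is the flow of $Y$. (P3) $Y^{TQ}(L)=0$.
   Context: All objects are smooth and all vector fields are complete. $Q$ is an $n$-dimensional manifold. The Lagrangian $L:TQ\to\mathbb{R}$ has the form $L=T+b-V\circ\pi$, with $T$ the kinetic energy of a Riemannian metric on $Q$, $b$ a 1-form on $Q$ regarded as a function on $TQ$, $V$ a function on $Q$, and $\pi:TQ\to Q$ the projection. $\mathcal{D}$ is a nonintegrable distribution on $Q$ of constant rank $r$, $1<r<n$, and $Z$ is a vector field on $Q$; $\Gamma(\mathcal{D})$ is the space of sections of $\mathcal{D}$. The affine constraint distribution $\mathcal{M}=Z+\mathcal{D}$ has fibers $\mathcal{M}_q=Z(q)+\mathcal{D}_q\subset T_qQ$; the submanifold $M\subset TQ$ with fibers $\mathcal{M}_q$ is the constraint manifold. $p$ is the momentum 1-form generated by $L$ (in coordinates $p=\partial L/\partial\dot q$), $E_L:=\langle p,\cdot\rangle-L$, and for a vector field $Y$ on $Q$, $E_{L,Y}:=E_L-\langle p,Y\rangle$, as functions on $TQ$. A moving energy of $(L,Q,\mathcal{M})$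 is a function $f:M\to\mathbb{R}$ for which there is a vector field $Y$ on $Q$, called a generator of $f$ (not unique in general), with $f=E_{L,Y}|_M$. The tangent lift of $Y$ is $Y^{TQ}=\sum_iY_i\partial_{q_i}+\sum_{i,j}\dot q_j\frac{\partial Y_i}{\partial q_j}\partial_{\dot q_i}$. Let $U$ be a manifold and $\mathcal{C}:\mathbb{R}\times U\to Q$ a time-dependent diffeomorphism: a smooth map such that each $\mathcal{C}_t=\mathcal{C}(t,\cdot):U\to Q$ is a diffeomorphism. Write $\mathcal{C}'_t$ for the derivative (Jacobian) of $\mathcal{C}_t$ and $\dot{\mathcal{C}}_t=\partial\mathcal{C}_t/\partial t$. The transformed Lagrangian and constraint distribution on $U$ are $\tilde L(u,\dot u,t)=L\big(\mathcal{C}_t(u),\mathcal{C}_t'(u)\dot u+\dot{\mathcal{C}}_t(u)\big)$ and $\tilde{\mathcal{M}}_{t,u}=\mathcal{C}_t'(u)^{-1}\big[\mathcal{D}_{\mathcal{C}_t(u)}+Z(\mathcal{C}_t(u))-\dot{\mathcal{C}}_t(u)\big]$. $E^*_{L,\mathcal{C}}:\mathbb{R}\times TQ\to\mathbb{R}$ is the push-forward of the energy $E_{\tilde L}$ under the tangent bundle lift $(t,u,\dot u)\mapsto(t,\mathcal{C}_t(u),\mathcal{C}_t'(u)\dot u+\dot{\mathcal{C}}_t(u))$; explicitly $E^*_{L,\mathcal{C}}=E_L-\langle p,\dot{\mathcal{C}}_t\circ\mathcal{C}_t^{-1}\rangle$. A moving energy of $(L,Q,\mathcal{M})$ is kinematically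 interpretable if it has a generator $Y$ and there exists a time-dependent diffeomorphism $\mathcal{C}:\mathbb{R}\times U\to Q$ such that $E_{L,Y}=E^*_{L,\mathcal{C}}$ (on $\mathbb R\times TQ$; in particular $E^*_{L,\mathcal{C}}$ is time-independent) and: (D1) $\tilde{\mathcal{M}}$ is a linear distribution (each $\tilde{\mathcal{M}}_{t,u}$ is a linear subspace of $T_uU$); (D2) $\tilde{\mathcal{M}}$ is time-independent; (D3) $\tilde L$ is time-independent. *)

(* Defs.v *)
From HB Require Import structures.
From mathcomp Require Import all_boot all_order all_algebra.
From mathcomp Require Import all_classical all_reals all_analysis.

Set Implicit Arguments.
Unset Strict Implicit.
Unset Printing Implicit Defensive.

Import Order.TTheory GRing.Theory Num.Theory.
Import numFieldNormedType.Exports.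

Local Open Scope classical_set_scope.
Local Open Scope ring_scope.

(* Only meant for open O and finite-dimensional V: then a map is C^(k+1) on O
   iff it is differentiable there and its directional derivatives are C^k. *)
Fixpoint Ck_on (R : realType) (V W : normedModType R) (k : nat)
    (O : set V) (f : V -> W) : Prop :=
  if k is k'.+1 then
    (forall x, O x -> differentiable f x) /\ (forall v, Ck_on k' O ('D_v f))
  else forall x, O x -> {for x, continuous f}.

Definition smooth_on (R : realType) (V W : normedModType R)
    (O : set V) (f : V -> W) : Prop := forall k, Ck_on k O f.

(* The smooth structure is given by one preferred chart around each point;
   every smooth structure has such an atlas. The functions chart p and
   chart_inv p are total, but only meaningful on dom p and chart p @` dom p. *)
Record manifold (R : realType) (n : nat) := Manifold {
  mf_point :> topologicalType;
  mf_hausdorff : hausdorff_space mf_point;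
  mf_second_countable : @second_countable mf_point;
  dom : mf_point -> set mf_point;
  chart : mf_point -> mf_point -> 'rV[R]_n;
  chart_inv : mf_point -> 'rV[R]_n -> mf_point;
  mem_dom : forall p, dom p p;
  open_dom : forall p, open (dom p);
  open_img : forall p, open (chart p @` dom p);
  chartK : forall p q, dom p q -> chart_inv p (chart p q) = q;
  chart_continuous : forall p q, dom p q -> {for q, continuous (chart p)};
  chart_inv_continuous : forall p x, (chart p @` dom p) x ->
    {for x, continuous (chart_inv p)};
  chart_compat : forall p p',
    smooth_on [set x | (chart p @` dom p) x /\ dom p' (chart_inv p x)]
              (chart p' \o chart_inv p) }.

Arguments dom {R n m} _ _ : rename.
Arguments chart {R n m} _ _ : rename.
Arguments chart_inv {R n m} _ _ : rename.

(* The chart at q identifies the tangent space at q with R^n: a tangent vector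
   at q is given by its components in the preferred chart at q. *)
Definition tangent (R : realType) (n : nat) (Q : manifold R n) (q : Q) :=
  'rV[R]_n.

Section Manifolds.
Variables (R : realType) (n : nat) (Q : manifold R n).

Definition img (p : Q) : set 'rV[R]_n := chart p @` dom p.

(* Passing from components in the chart at p to components in the chart at p',
   for tangent vectors at q. In particular coord_change q p q v are the
   components of v : tangent q in the chart at p, and coord_change p q q w is
   the tangent vector at q whose components in the chart at p are w. *)
Definition coord_change (p p' q : Q) (v : 'rV[R]_n) : 'rV[R]_n :=
  'd (chart p' \o chart_inv p) (chart p q) v.

Definition smooth_into (V : normedModType R) (O : set V) (F : V -> Q) : Prop :=
  (forall x, O x -> {for x, continuous F}) /\
  (forall p : Q, smooth_on [set x | O x /\ dom p (F x)] (chart p \o F)).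

Definition velocity (c : R -> Q) (t : R) : tangent (c t) :=
  derive1 (chart (c t) \o c) t.

Definition smooth_fun (h : Q -> R) : Prop :=
  forall p : Q, smooth_on (img p) (h \o chart_inv p).

Definition field_in_chart (p : Q) (X : forall q : Q, tangent q)
    (x : 'rV[R]_n) : 'rV[R]_n :=
  let q := chart_inv p x in coord_change q p q (X q).

Definition smooth_field_on (O : set Q) (X : forall q : Q, tangent q) : Prop :=
  forall p : Q,
    smooth_on [set x | img p x /\ O (chart_inv p x)] (field_in_chart p X).

Definition smooth_field (X : forall q : Q, tangent q) : Prop :=
  smooth_field_on setT X.

End Manifolds.

Section MapsBetweenManifolds.
Variables (R : realType) (m n : nat) (U : manifold R m) (Q : manifold R n).

Definition smooth_map (F : U -> Q) : Prop :=
  forall u : U, smooth_into (img u) (F \o chart_inv u).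

Definition smooth_time_map (F : R -> U -> Q) : Prop :=
  forall u : U, smooth_into [set z : R * 'rV[R]_m | img u z.2]
                            (fun z => F z.1 (chart_inv u z.2)).

Definition tangent_map (F : U -> Q) (u : U) (w : tangent u) : tangent (F u) :=
  'd (chart (F u) \o F \o chart_inv u) (chart u u) w.

End MapsBetweenManifolds.

Arguments tangent_map {R m n U Q} F u w.

Section TimeDependentDiffeomorphisms.
Variables (R : realType) (m n : nat) (U : manifold R m) (Q : manifold R n).

Record time_dep_diffeo := TimeDepDiffeo {
  tdd :> R -> U -> Q;
  tdd_inv : R -> Q -> U;
  tdd_smooth : smooth_time_map tdd;
  tdd_inv_smooth : forall t, smooth_map (tdd_inv t);
  tddK : forall t, cancel (tdd t) (tdd_inv t);
  tdd_invK : forall t, cancel (tdd_inv t) (tdd t) }.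

Definition tdd_dot (C : time_dep_diffeo) (t : R) (u : U) : tangent (C t u) :=
  velocity (fun s => C s u) t.

End TimeDependentDiffeomorphisms.

Section Geometry.
Variables (R : realType) (n : nat) (Q : manifold R n).

Definition is_global_flow (X : forall q : Q, tangent q) (Phi : R -> Q -> Q)
    : Prop :=
  [/\ smooth_time_map Phi,
      forall q, Phi 0 q = q,
      forall s t q, Phi (s + t) q = Phi s (Phi t q) &
      forall t q, velocity (fun s => Phi s q) t = X (Phi t q)].

(* All vector fields are complete, in the sense that they generate a global
   flow. *)
Record vector_field := VectorField {
  vf :> forall q : Q, tangent q;
  vf_smooth : smooth_field vf;
  vf_complete : exists Phi, is_global_flow vf Phi }.

Definition flow (X : vector_field) : R -> Q -> Q :=
  projT1 (cid (vf_complete X)).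

Record riemannian_metric := RiemannianMetric {
  metric_fun :> forall q : Q, tangent q -> tangent q -> R;
  metric_linear : forall (q : Q) (v : tangent q), scalar (metric_fun v);
  metric_sym : forall (q : Q) (v w : tangent q),
    metric_fun v w = metric_fun w v;
  metric_gt0 : forall (q : Q) (v : tangent q), v != 0 -> 0 < metric_fun v v;
  metric_smooth : forall (p : Q) (v w : 'rV[R]_n),
    smooth_on (img p) (fun x => let q := chart_inv p x in
      @metric_fun q (coord_change p q q v) (coord_change p q q w)) }.

Record one_form := OneForm {
  form_fun :> forall q : Q, tangent q -> R;
  form_linear : forall q : Q, scalar (@form_fun q);
  form_smooth : forall (p : Q) (v : 'rV[R]_n),
    smooth_on (img p) (fun x => let q := chart_inv p x in
      @form_fun q (coord_change p q q v)) }.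

(* Constant-rank smooth distribution: locally spanned by smooth fields. *)
Record smooth_distribution (r : nat) := SmoothDistribution {
  fiber :> forall q : Q, {vspace (tangent q)};
  fiber_rank : forall q : Q, (\dim (fiber q) = r)%N;
  fiber_smooth : forall q0 : Q, exists2 O : set Q, open O /\ O q0 &
    exists2 X : 'I_r -> forall q : Q, tangent q,
      forall i, smooth_field_on O (X i) &
      forall q, O q -> fiber q = <<[seq X i q | i <- enum 'I_r]>>%VS }.

(* Through every point there is an integral manifold, given by a local
   parametrization; it is an immersion since its differential at each point has
   the r-dimensional fiber as its range. *)
Definition integrable_distribution (r : nat) (D : smooth_distribution r)
    : Prop :=
  forall q0 : Q, exists (O : set 'rV[R]_r) (iota : 'rV[R]_r -> Q),
    [/\ open O, O 0, iota 0 = q0, smooth_into O iota &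
        forall x, O x -> forall w : tangent (iota x),
          w \in D (iota x) <->
          exists v : 'rV[R]_r, w = 'd (chart (iota x) \o iota) x v].

Definition is_section (r : nat) (D : smooth_distribution r)
    (X : forall q : Q, tangent q) : Prop :=
  smooth_field X /\ forall q, X q \in D q.

Definition invariant_under (r : nat) (D : smooth_distribution r)
    (Y : vector_field) : Prop :=
  forall (t : R) (q : Q),
    [set` D (flow Y t q)] = tangent_map (flow Y t) q @` [set` D q].

Definition constraint_manifold (r : nat) (Z : vector_field)
    (D : smooth_distribution r) : Type :=
  {x : {q : Q & tangent q} | tagged x - Z (tag x) \in D (tag x)}.

Definition lagrangian (g : riemannian_metric) (b : one_form) (V : Q -> R)
    (q : Q) (v : tangent q) : R :=
  2^-1 * g q v v + b q v - V q.

(* Functions on TQ are curried: base point first, then tangent vector. *)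
Variable L : forall q : Q, tangent q -> R.

(* <p(q,v), w>, with p the fibre derivative of L *)
Definition momentum (q : Q) (v w : tangent q) : R := 'D_w (@L q) v.

Definition energy (q : Q) (v : tangent q) : R := momentum v v - L v.

Definition energy_along (Y : vector_field) (q : Q) (v : tangent q) : R :=
  energy v - momentum v (Y q).

Definition is_generator (r : nat) (Z : vector_field) (D : smooth_distribution r)
    (f : constraint_manifold Z D -> R) (Y : vector_field) : Prop :=
  forall x, f x = energy_along Y (tagged (val x)).

Definition moving_energy (r : nat) (Z : vector_field)
    (D : smooth_distribution r) (f : constraint_manifold Z D -> R) : Prop :=
  exists Y, is_generator f Y.

(* L read in the bundle chart of TQ induced by the chart at p *)
Definition fun_in_chart (p : Q) (z : 'rV[R]_n * 'rV[R]_n) : R :=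
  let q := chart_inv p z.1 in @L q (coord_change p q q z.2).

(* Y^TQ(L) at (q, v), computed in the chart at q: the tangent lift has
   components Y_i in the base and \sum_j v_j dY_i/dq_j = 'D_v Y_i in the
   fibre. *)
Definition tangent_lift_deriv (Y : vector_field) (q : Q) (v : tangent q) : R :=
  let Yq := field_in_chart q Y in
  let x := chart q q in
  'D_((Yq x, 'D_v Yq x) : 'rV[R]_n * 'rV[R]_n) (fun_in_chart q) (x, v).

End Geometry.

Section MovingEnergies.
Variables (R : realType) (m n r : nat) (U : manifold R m) (Q : manifold R n).
Variables (L : forall q : Q, tangent q -> R).
Variables (Z : vector_field Q) (D : smooth_distribution Q r).
Variable (C : time_dep_diffeo U Q).

Definition transformed_lagrangian (t : R) (u : U) (w : tangent u) : R :=
  @L (C t u) (tangent_map (C t) u w + tdd_dot C t u).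

(* The preimage under C_t'(u) of D + Z - dC_t/dt at C_t(u) *)
Definition transformed_constraint (t : R) (u : U) : set (tangent u) :=
  [set w | exists2 d : tangent (C t u), d \in D (C t u) &
     tangent_map (C t) u w = d + Z (C t u) - tdd_dot C t u].

(* Push-forward of the energy of the transformed Lagrangian: its value at the
   point (t, u, w) with C_t(u) = q and C_t'(u) w + dC_t/dt(u) = v. *)
Definition pushed_energy (t : R) (q : Q) (v : tangent q) : R :=
  let u := tdd_inv C t q in
  energy (transformed_lagrangian t)
    (tangent_map (tdd_inv C t) q (v - tdd_dot C t u) : tangent u).

End MovingEnergies.

Arguments transformed_constraint {R m n r U Q} Z D C t u.

Definition kinematically_interpretable (R : realType) (n r : nat)
    (Q : manifold R n) (L : forall q : Q, tangent q -> R)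
    (Z : vector_field Q) (D : smooth_distribution Q r)
    (f : constraint_manifold Z D -> R) : Prop :=
  exists Y : vector_field Q, is_generator L f Y /\
  exists (m : nat) (U : manifold R m) (C : time_dep_diffeo U Q),
    [/\ forall t (q : Q) (v : tangent q),
          energy_along L Y v = pushed_energy L C t v,
        forall t (u : U), exists W : {vspace (tangent u)},
          transformed_constraint Z D C t u = [set` W],
        forall s t (u : U),
          transformed_constraint Z D C s u = transformed_constraint Z D C t u &
        forall s t (u : U) (w : tangent u),
          transformed_lagrangian L C s w = transformed_lagrangian L C t w].

(* Main.v *)
Require Import Defs.
From HB Require Import structures.
From mathcomp Require Import all_boot all_order all_algebra.
From mathcomp Require Import all_classical all_reals all_analysis.
From mathcomp Require Import lra ring.

Set Implicit Arguments.
Unset Strict Implicit.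
Unset Printing Implicit Defensive.

Import Order.TTheory GRing.Theory Num.Theory.
Import numFieldNormedType.Exports.

Local Open Scope classical_set_scope.
Local Open Scope ring_scope.

(** A time-dependent diffeomorphism C has pushed energy E_{L,Y} exactly when
    its curves are integral curves of Y: the two energies differ by
    <p(v), C_t' - Y> at every v, and p is affine in v with the nondegenerate
    metric as linear part. By uniqueness of integral curves C_t is then the
    flow Phi_t of Y composed with C_0, and the conditions on C translate one by
    one: (D1) puts Z - Y in D, (D2) becomes the invariance of D under Phi_t,
    and (D3) the invariance of L under the tangent maps of Phi_t, since
    Phi_t' w + Y = Phi_t' (w + Y). The last one is infinitesimally
    Y^TQ(L) = 0, because v |-> Phi_t' v is the flow of Y^TQ (equality of mixed
    partial derivatives). Conversely C := Phi works, with U := Q. *)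

(** * Differentials of locally equal maps *)

Lemma near_eq_is_diff (R : numFieldType) (V W : normedModType R)
    (f g df : V -> W) (x : V) :
  {near x, f =1 g} -> is_diff x f df -> is_diff x g df.
Proof.
move=> fg [fx <-].
(* The first-order expansion of [f] at [x] is also one of [g], since its error term is only tested
   near 0; uniqueness of the differential then concludes. *)
have [dfc fE] := (diff_locallyP x f).1 fx.
have gE : g \o shift x = cst (g x) + 'd f x +o_ 0 id.
  apply/eqaddoP => e e0.
  have /eqaddoP/(_ e e0) := fE.
  have fg' : \forall h \near 0, f (h + x) = g (h + x).
    by have := fg; rewrite (near_shift 0 x); apply: filterS => y /=; rewrite subr0.
  apply: filterS2 fg' => h hfg; apply: le_trans.
  by rewrite /= !fctE /= hfg (nbhs_singleton fg).
have dg : 'd g x = 'd f x :> (V -> W) by exact: diff_unique.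
apply: DiffDef; last exact: dg.
by apply/diff_locallyP; rewrite dg.
Qed.

Lemma is_diffE (R : numFieldType) (V W : normedModType R) (f df : V -> W)
    (x : V) : is_diff x f df -> 'd f x =1 df.
Proof. by move=> dfx v; rewrite diff_val. Qed.

Lemma is_diff_differentiable (R : numFieldType) (V W : normedModType R)
    (f df : V -> W) (x : V) : is_diff x f df -> differentiable f x.
Proof. by case. Qed.

(** * Directional derivatives and the symmetry of second derivatives *)

Section Schwarz.
Variables (R : realType) (V : normedModType R).

Lemma is_derive_line (W : normedModType R) (f : V -> W) (x a : V) (t : R) :
  differentiable f (x + t *: a) ->
  is_derive t 1 (fun s : R => f (x + s *: a)) ('D_a f (x + t *: a)).
Proof.
move=> df.
have da : is_diff t (fun s : R => x + s *: a) (fun s => s *: a).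
  rewrite -[X in is_diff _ _ X]add0r.
  have -> : (fun s : R => x + s *: a) = cst x + (fun s => s *: a) by apply/funext.
  exact: is_diffD.
have dd := is_diff_comp da (differentiableP df).
apply: DeriveDef.
  by apply/derivable1_diffP; exact: (@ex_diff _ _ _ _ _ _ _ dd).
rewrite deriveE; last exact: (@ex_diff _ _ _ _ _ _ _ dd).
by rewrite (@diff_val _ _ _ _ _ _ _ dd) /= scale1r deriveE.
Qed.

(** The mean value theorem applied twice: along [a] to the increment of [f] in the direction [b],
    then along [b] to ['D_a f]. The left-hand side is symmetric in [a] and [b], which is what makes
    the formula useful. *)
Lemma second_difference (f : V -> R) (x a b : V) (h : R) : 0 < h ->
  (forall s t, 0 <= s <= h -> 0 <= t <= h ->
    differentiable f (x + s *: a + t *: b) /\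
    differentiable ('D_a f) (x + s *: a + t *: b)) ->
  exists s t, [/\ 0 <= s <= h, 0 <= t <= h &
    f (x + h *: a + h *: b) - f (x + h *: a) - f (x + h *: b) + f x =
    'D_b ('D_a f) (x + s *: a + t *: b) * h * h].
Proof.
move=> h0 df.
(* The second difference is [phi h - phi 0]. *)
pose phi (s : R) := f (x + h *: b + s *: a) - f (x + s *: a).
pose dphi (s : R) := 'D_a f (x + h *: b + s *: a) - 'D_a f (x + s *: a).
have hh : 0 <= h <= h by rewrite ltW //=.
have oo : 0 <= (0 : R) <= h by rewrite lexx ltW.
have dphiE s : 0 <= s <= h -> is_derive s 1 phi (dphi s).
  move=> sh; apply: is_deriveB; apply: is_derive_line.
    by rewrite addrAC; have [] := df _ _ sh hh.
  by have [] := df _ _ sh oo; rewrite scale0r addr0.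
have itvP' c : c \in `]0, h[%R -> 0 <= c <= h.
  by rewrite in_itv /= => /andP[/ltW -> /ltW ->].
have [|s /itvP' sh] := MVT h0 (fun s sh => dphiE s (itvP' s sh)).
  apply: derivable_within_continuous => s; rewrite in_itv /= => /dphiE sh.
  exact: ex_derive.
rewrite subr0 => phiE.
pose psi (t : R) := 'D_a f (x + s *: a + t *: b).
have dpsiE t : 0 <= t <= h ->
    is_derive t 1 psi ('D_b ('D_a f) (x + s *: a + t *: b)).
  by move=> th; apply: is_derive_line; have [] := df _ _ sh th.
have [|t /itvP' th] := MVT h0 (fun s sh => dpsiE s (itvP' s sh)).
  apply: derivable_within_continuous => t; rewrite in_itv /= => /dpsiE th.
  exact: ex_derive.
rewrite subr0 => psiE.
exists s, t; split => //.
have -> : 'D_b ('D_a f) (x + s *: a + t *: b) * h = dphi s.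
  by rewrite -psiE /psi /dphi scale0r addr0 [x + s *: a + _]addrAC.
rewrite -phiE /phi scale0r !addr0 [x + h *: b + _]addrAC.
by rewrite opprB addrA addrAC; ring.
Qed.

(** The second difference over a small parallelogram equals [h * h] times either mixed derivative,
    each at some point of the parallelogram. Both derivatives are continuous at [x], so their values
    there differ by at most any [e > 0]. *)
Theorem Schwarz (f : V -> R) (O : set V) (x a b : V) :
  open O -> O x -> Ck_on 2 O f -> 'D_a ('D_b f) x = 'D_b ('D_a f) x.
Proof.
move=> oO Ox [df d2f].
have dab c : (forall y, O y -> differentiable ('D_c f) y) /\
   (forall e, {for x, continuous ('D_e ('D_c f))}).
  by have [d1 d2] := d2f c; split => // e; exact: d2.
apply/eqP; rewrite -subr_eq0 -normr_le0; apply/ler_addgt0Pr => _/posnumP[e].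
rewrite add0r.
have e2 : 0 < e%:num / 2 :> R by [].
have /cvgrPdist_lt/(_ _ e2) nab := (dab b).2 a.
have /cvgrPdist_lt/(_ _ e2) nba := (dab a).2 b.
have nO : \forall y \near x, O y by exact: open_nbhs_nbhs.
have /nbhs_ballP[d /= d0 dP] : \forall y \near x, [/\ O y,
    `|'D_a ('D_b f) x - 'D_a ('D_b f) y| < e%:num / 2 &
    `|'D_b ('D_a f) x - 'D_b ('D_a f) y| < e%:num / 2].
  apply: (filterS _ (filterI nO (filterI nab nba))) => y [y1 [y2 y3]].
  exact: And3 y1 y2 y3.
(* The parallelogram of side parameter [h] stays within [h * m = d / 2] of [x]; the summand 1 keeps
   [m] positive when [a = b = 0]. *)
pose m := `|a| + `|b| + 1.
have m0 : 0 < m by rewrite ltr_wpDl // addr_ge0.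
pose h := d / 2 / m.
have h0 : 0 < h by rewrite !divr_gt0.
have inball s t : 0 <= s <= h -> 0 <= t <= h -> ball x d (x + s *: a + t *: b).
  move=> /andP[s0 sh] /andP[t0 th].
  rewrite -ball_normE /ball_ /= -addrA opprD addNKr normrN.
  apply: le_lt_trans (ler_normD _ _) _; rewrite !normrZ !ger0_norm //.
  apply: (@le_lt_trans _ _ (h * m)); last first.
    by rewrite divfK ?gt_eqF // ltr_pdivrMr // ltr_pMr // ltr1n.
  rewrite /m mulrDr mulr1 mulrDr -[leLHS]addr0 lerD ?(ltW h0) // lerD //;
  by apply: ler_wpM2r.
have inball' s t : 0 <= s <= h -> 0 <= t <= h -> ball x d (x + t *: b + s *: a).
  by rewrite addrAC; exact: inball.
have [|s [t [sh th E1]]] := @second_difference f x a b h h0.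
  move=> s t sh th; have [Oy _ _] := dP _ (inball _ _ sh th).
  by split; [exact: df|exact: (dab a).1].
have [|t' [s' [th' sh' E2]]] := @second_difference f x b a h h0.
  move=> t' s' th' sh'; have [Oy _ _] := dP _ (inball' _ _ sh' th').
  by split; [exact: df|exact: (dab b).1].
have EE : 'D_b ('D_a f) (x + s *: a + t *: b) =
          'D_a ('D_b f) (x + t' *: b + s' *: a).
  apply: (mulIf (lt0r_neq0 h0)); apply: (mulIf (lt0r_neq0 h0)).
  apply: etrans (esym E1) _; apply: etrans _ E2.
  by rewrite (addrAC x (h *: b)); congr (_ + _); exact: addrAC.
have [_ _ /= B1] := dP _ (inball _ _ sh th).
have [_ /= B2 _] := dP _ (inball' _ _ sh' th').
rewrite -(subrKA ('D_a ('D_b f) (x + t' *: b + s' *: a))).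
apply: le_trans (ler_normD _ _) _.
rewrite [leRHS]splitr; apply: lerD; first exact: ltW B2.
by rewrite -EE distrC; exact: ltW B1.
Qed.

Lemma derive_coord (n : nat) (F : V -> 'rV[R]_n) (x a : V) (j : 'I_n) :
  derivable F x a -> 'D_a F x 0 j = 'D_a (fun y => F y 0 j) x.
Proof. by move=> dF; rewrite derive_mx // mxE. Qed.

End Schwarz.

Lemma derive_slice (R : realType) (V W : normedModType R)
    (f : R * V -> W) (t : R) (x v : V) :
  'D_v (fun y => f (t, y)) x = 'D_((0, v) : R * V) f (t, x).
Proof.
apply: (congr1 (fun u : R -> W => lim (u @ 0^'))); apply/funext => h /=.
congr (_ *: (f _ - _)); apply/pair_equal_spec; split => //=.
by rewrite scaler0 add0r.
Qed.

(** Both difference quotients are the same function of [h]. This computes the fibre derivative of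
    the transformed Lagrangian, which is [L] after an affine map on each fibre. *)
Lemma derive_affine (R : realType) (V W X : normedModType R) (f : W -> X)
    (A : V -> W) (c : W) (w a : V) : linear A ->
  'D_a (fun w => f (A w + c)) w = 'D_(A a) f (A w + c).
Proof.
move=> linA.
apply: (congr1 (fun u : R -> X => lim (u @ 0^'))); apply/funext => h /=.
by rewrite linA addrA.
Qed.

(** Along the line through [v] the function is a polynomial in [h], and the directional derivative
    is its linear coefficient. *)
Lemma derive_quadratic (R : realType) (V : normedModType R) (f : V -> R)
    (v w : V) (a c : R) :
  (forall h, f (h *: w + v) = f v + h * a + h * h * c) -> 'D_w f v = a.
Proof.
move=> fE.
have -> : 'D_w f v = 'D_1 (fun h : R => f (h *: w + v)) 0.
  apply: (congr1 (fun u : R -> R => lim (u @ 0^'))); apply/funext => h /=.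
  by rewrite addr0 scale0r add0r [_%:A]mulr1.
have -> : (fun h : R => f (h *: w + v)) = (fun h => f v + h * a + h * h * c).
  exact/funext.
by rewrite derive_val !scaler0 !scale0r !(add0r, addr0) scaler0 addr0 mul1r
  [_%:A]mulr1.
Qed.

(* Otherwise unifying two distinct derivatives unfolds their limits and may
   not terminate. *)
Local Opaque diff derive.

(** * Maps of class C^k: local equality, differences, slices and components *)

Section Ck.
Variables (R : realType) (V W : normedModType R).

Lemma open_near (T : topologicalType) (O : set T) (P : T -> Prop) (x : T) :
  open O -> O x -> (forall y, O y -> P y) -> \forall y \near x, P y.
Proof.
by move=> oO Ox OP; apply: (filterS OP); apply: open_nbhs_nbhs; split.
Qed.

(** Since [O] is open, equality on [O] is equality near each of its points, so it passes to all
    directional derivatives. *)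
Lemma Ck_on_ext (k : nat) (O : set V) (f g : V -> W) :
  open O -> (forall x, O x -> f x = g x) -> Ck_on k O f -> Ck_on k O g.
Proof.
move=> oO; elim: k f g => [|k IH] f g fg /=.
  move=> cf x Ox A; rewrite -(fg x Ox) => /(cf x Ox) fA.
  have nA : nbhs x (fun y => A (f y)) := fA.
  suff : nbhs x (fun y => A (g y)) by [].
  by apply: (filterS _ (filterI (open_near oO Ox fg) nA)) => y [/= ->].
move=> [df dDf]; split => [x Ox|v].
  apply: is_diff_differentiable.
  exact: near_eq_is_diff (open_near oO Ox fg) (differentiableP (df x Ox)).
apply: IH (dDf v) => x Ox; apply: near_eq_derive.
exact: (open_near oO Ox fg).
Qed.

Lemma Ck_onB (k : nat) (O : set V) (f g : V -> W) :
  open O -> Ck_on k O f -> Ck_on k O g -> Ck_on k O (fun x => f x - g x).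
Proof.
move=> oO; elim: k f g => [|k IH] f g /=.
  by move=> cf cg x Ox; apply: continuousB; [exact: cf|exact: cg].
move=> [df dDf] [dg dDg]; split => [x Ox|v].
  by apply: differentiableB; [exact: df|exact: dg].
apply: Ck_on_ext oO _ (IH _ _ (dDf v) (dDg v)) => x Ox.
by rewrite -deriveB //; apply: diff_derivable; [exact: df|exact: dg].
Qed.

End Ck.

Section Slices.
Variables (R : realType) (V W : normedModType R).

Lemma is_diff_pairl (v : R) (w : V) :
  is_diff v (fun v => (v, w)) (fun h => (h, 0)).
Proof. exact: is_diff_pair. Qed.

Lemma is_diff_pairr (v : R) (w : V) :
  is_diff w (fun w => (v, w)) (fun h => (0, h)).
Proof. exact: is_diff_pair. Qed.

Lemma open_slice (O : set (R * V)) (t : R) : open O -> open [set x | O (t, x)].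
Proof.
move=> oO; apply: (@open_comp _ _ (fun x => (t, x))) => // x _.
exact: differentiable_continuous (is_diff_differentiable (is_diff_pairr t x)).
Qed.

Lemma Ck_on_slice (k : nat) (O : set (R * V)) (f : R * V -> W) (t : R) :
  open O -> Ck_on k O f -> Ck_on k [set x | O (t, x)] (fun x => f (t, x)).
Proof.
move=> oO; have oOt := open_slice t oO.
elim: k f => [|k IH] f /=.
  move=> cf x Ox; apply: continuous_comp; last exact: cf.
  exact: differentiable_continuous (is_diff_differentiable (is_diff_pairr t x)).
move=> [df dDf]; split => [x Ox|v].
  exact: is_diff_differentiable
    (is_diff_comp (is_diff_pairr t x) (differentiableP (df _ Ox))).
by apply: Ck_on_ext oOt _ (IH _ (dDf (0, v))) => x Ox; rewrite derive_slice.
Qed.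

End Slices.

Section Schwarz_rV.
Variables (R : realType) (V : normedModType R) (n : nat).

Lemma Ck_on_coord (k : nat) (O : set V) (F : V -> 'rV[R]_n) (j : 'I_n) :
  open O -> Ck_on k O F -> Ck_on k O (fun x => F x 0 j).
Proof.
move=> oO; elim: k F => [|k IH] F /=.
  move=> cF x Ox; apply: (@continuous_comp _ _ _ F (fun M : 'rV[R]_n => M 0 j)).
    exact: cF.
  exact: coord_continuous.
move=> [dF dDF]; split => [x Ox|v].
  apply: (@differentiable_comp _ _ _ _ F (fun M : 'rV[R]_n => M 0 j)).
    exact: dF.
  exact: differentiable_coord.
apply: Ck_on_ext oO _ (IH _ (dDF v)) => x Ox.
by apply: derive_coord; apply: diff_derivable; exact: dF.
Qed.

Theorem Schwarz_rV (F : V -> 'rV[R]_n) (O : set V) (x a b : V) :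
  open O -> O x -> Ck_on 2 O F -> 'D_a ('D_b F) x = 'D_b ('D_a F) x.
Proof.
move=> oO Ox F2; have [dF dDF] := F2; apply/rowP => j.
have DD c e : 'D_c ('D_e F) x 0 j = 'D_c ('D_e (fun y => F y 0 j)) x.
  rewrite derive_coord; last by apply: diff_derivable; exact: (dDF e).1.
  apply: near_eq_derive; apply: (open_near oO Ox) => y Oy.
  by apply: derive_coord; apply: diff_derivable; exact: dF.
apply: etrans (DD a b) _; apply: etrans _ (esym (DD b a)).
exact: Schwarz oO Ox (Ck_on_coord j oO F2).
Qed.

End Schwarz_rV.

(** * Differential calculus in charts *)

Section Charts.
Variables (R : realType) (n : nat) (Q : manifold R n).

Lemma img_chart (p q : Q) : dom p q -> img p (chart p q).
Proof. by move=> pq; exists q. Qed.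

Lemma chartKp (q : Q) : chart_inv q (chart q q) = q.
Proof. by rewrite chartK //; exact: mem_dom. Qed.

Lemma img_chartp (q : Q) : img q (chart q q).
Proof. by apply: img_chart; exact: mem_dom. Qed.

Lemma chart_invK (p : Q) x : img p x -> chart p (chart_inv p x) = x.
Proof. by case=> q pq <-; rewrite chartK. Qed.

Lemma dom_chart_inv (p : Q) x : img p x -> dom p (chart_inv p x).
Proof. by case=> q pq <-; rewrite chartK. Qed.

Lemma near_dom (p q : Q) : dom p q -> \forall q' \near q, dom p q'.
Proof. by move=> pq; apply: open_nbhs_nbhs; split => //; exact: open_dom. Qed.

Lemma near_img (p : Q) x : img p x -> \forall y \near x, img p y.
Proof. by move=> px; apply: open_nbhs_nbhs; split => //; exact: open_img. Qed.

Lemma transition_differentiable (p p' q : Q) : dom p q -> dom p' q ->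
  differentiable (chart p' \o chart_inv p) (chart p q).
Proof.
move=> pq p'q; have [+ _] := @chart_compat _ _ Q p p' 1%N; apply => /=.
by rewrite chartK //; split => //; exact: img_chart.
Qed.

(** By continuity [f] stays in [dom p] near [x], where [h \o f] factors through the chart at [p];
    the rest is the chain rule in normed spaces. *)
Lemma is_diff_through_chart (V W : normedModType R) (f : V -> Q) (h : Q -> W)
    (p : Q) (x : V) :
  {for x, continuous f} -> dom p (f x) -> differentiable (chart p \o f) x ->
  differentiable (h \o chart_inv p) (chart p (f x)) ->
  is_diff x (h \o f)
    ('d (h \o chart_inv p) (chart p (f x)) \o 'd (chart p \o f) x).
Proof.
move=> fx pfx df dh.
apply: (@near_eq_is_diff _ _ _ ((h \o chart_inv p) \o (chart p \o f))); last first.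
  exact: (is_diff_comp (differentiableP df) (differentiableP dh)).
have nfx : \forall y \near x, dom p (f y) := fx _ (near_dom pfx).
apply: filterS nfx => y py /=.
by rewrite chartK.
Qed.

(** Continuity is a separate clause because [chart (f x)] is total with arbitrary values off its
    domain: differentiability of the composite does not by itself keep [f] inside the chart. *)
Definition mdifferentiable (V : normedModType R) (f : V -> Q) (x : V) : Prop :=
  {for x, continuous f} /\ differentiable (chart (f x) \o f) x.

Definition mdiff (V : normedModType R) (f : V -> Q) (x : V) :
  V -> tangent (f x) := 'd (chart (f x) \o f) x.

Lemma smooth_into_mdifferentiable (V : normedModType R) (O : set V)
    (F : V -> Q) x :
  smooth_into O F -> O x -> mdifferentiable F x.
Proof.
move=> [cF dF] Ox; split; first exact: cF.
by have [+ _] := dF (F x) 1%N; apply; split => //; exact: mem_dom.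
Qed.

Lemma smooth_into_open (V : normedModType R) (O : set V) (F : V -> Q) (p : Q) :
  open O -> smooth_into O F -> open [set x | O x /\ dom p (F x)].
Proof.
move=> oO [cF _]; rewrite openE => x [Ox px].
have nd : nbhs x (fun y => dom p (F y)) := cF x Ox _ (near_dom px).
have nO : nbhs x O by apply: open_nbhs_nbhs; split.
exact: filterI nO nd.
Qed.

Lemma mdifferentiable_chart (V : normedModType R) (f : V -> Q) x p :
  mdifferentiable f x -> dom p (f x) ->
  is_diff x (chart p \o f) (coord_change (f x) p (f x) \o mdiff f x).
Proof.
move=> [cf df] pfx; apply: is_diff_through_chart => //.
  exact: mem_dom.
exact: (transition_differentiable (mem_dom _) pfx).
Qed.

Lemma diff_chart_change (V : normedModType R) (f : V -> Q) x p p' :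
  mdifferentiable f x -> dom p (f x) -> dom p' (f x) ->
  'd (chart p' \o f) x =1 coord_change p p' (f x) \o 'd (chart p \o f) x.
Proof.
move=> mf pfx p'fx v.
apply: is_diffE; apply: is_diff_through_chart.
- exact: mf.1.
- exact: pfx.
- exact: is_diff_differentiable (mdifferentiable_chart mf pfx).
- exact: transition_differentiable.
Qed.

Lemma coord_change_id (p q : Q) v : dom p q -> coord_change p p q v = v.
Proof.
move=> pq.
apply: is_diffE.
apply: (@near_eq_is_diff _ _ _ id).
  have := near_img (img_chart pq); apply: filterS => y py /=.
  by rewrite chart_invK.
Qed.

Lemma coord_change_linear (p p' q : Q) : linear (@coord_change _ _ Q p p' q).
Proof. by move=> a v w; rewrite /coord_change linearP. Qed.

Lemma velocityE (c : R -> Q) t : mdifferentiable c t ->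
  velocity c t = mdiff c t 1.
Proof. by move=> [_ dc]; rewrite /velocity derive1E'. Qed.

End Charts.

(** * Maps between manifolds and their tangent maps *)

Section Maps.
Variables (R : realType).

Definition mapdiff (m n : nat) (U : manifold R m) (Q : manifold R n)
    (F : U -> Q) (u : U) : Prop :=
  {for u, continuous F} /\
  differentiable (chart (F u) \o F \o chart_inv u) (chart u u).

Variables (m n : nat) (U : manifold R m) (Q : manifold R n).

Lemma mapdiffE (F : U -> Q) u :
  mapdiff F u <-> mdifferentiable (F \o chart_inv u) (chart u u).
Proof.
split=> [[cF dF]|[cF]]; rewrite /mdifferentiable /= chartKp.
  split => //; apply: continuous_comp.
    exact: chart_inv_continuous (img_chartp u).
  by rewrite chartKp.
move=> dF; split => //.
(* Continuity of [F] is recovered from its chart representation, with which it agrees only on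
   [dom u]. *)
have : {for u, continuous ((F \o chart_inv u) \o chart u)}.
  by apply: continuous_comp => //; apply: chart_continuous; exact: mem_dom.
move=> h A FA; have := h A; rewrite /= chartKp => /(_ FA) hA.
have nu : nbhs u (dom u) := near_dom (mem_dom u).
have nA : nbhs u (fun v => A (F (chart_inv u (chart u v)))) := hA.
suff : nbhs u (fun v => A (F v)) by [].
apply: (filterS _ (filterI nu nA)) => v [uv] /=.
by rewrite chartK.
Qed.

Lemma tangent_mapE (F : U -> Q) u :
  tangent_map F u =1 mdiff (F \o chart_inv u) (chart u u).
Proof.
by move=> w; rewrite /tangent_map /mdiff /= chartKp.
Qed.

Lemma smooth_map_mapdiff (F : U -> Q) u : smooth_map F -> mapdiff F u.
Proof.
move=> /(_ u) /smooth_into_mdifferentiable sF; apply/mapdiffE; apply: sF.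
exact: img_chartp.
Qed.

Lemma mdiff_comp (V : normedModType R) (f : V -> U) (F : U -> Q) x :
  mdifferentiable f x -> mapdiff F (f x) ->
  mdifferentiable (F \o f) x /\
  mdiff (F \o f) x =1 tangent_map F (f x) \o mdiff f x.
Proof.
move=> [cf df] [cF dF].
have [dFf E] := @is_diff_through_chart _ _ _ _ _ f (chart (F (f x)) \o F)
  (f x) x cf (mem_dom _) df dF.
split; last first.
  by move=> v; rewrite /mdiff -[LHS]/('d (chart (F (f x)) \o F \o f) x v) E.
by split => //; exact: continuous_comp.
Qed.

Lemma tangent_map_linear (F : U -> Q) u : linear (tangent_map F u).
Proof. by move=> a v w; rewrite /tangent_map linearP. Qed.

End Maps.

Section Composition.
Variables (R : realType) (l m n : nat).
Variables (T : manifold R l) (U : manifold R m) (Q : manifold R n).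

Lemma tangent_map_comp (F : T -> U) (G : U -> Q) u :
  mapdiff F u -> mapdiff G (F u) ->
  mapdiff (G \o F) u /\
  forall w : tangent u,
    tangent_map (G \o F) u w = tangent_map G (F u) (tangent_map F u w).
Proof.
move=> /mapdiffE dF dG.
have := @mdiff_comp _ _ _ _ _ _ (F \o chart_inv u) G (chart u u) dF.
rewrite /= chartKp => /(_ dG) [dGF E]; split; first exact/mapdiffE.
move=> w; rewrite (tangent_mapE (G \o F)) (tangent_mapE F).
exact: E.
Qed.

End Composition.

Lemma tangent_map_id (R : realType) (n : nat) (Q : manifold R n) (q : Q)
    (w : tangent q) :
  tangent_map id q w = w.
(* By conversion, the tangent map of the identity is the change from the chart at [q] to itself. *)
Proof. by rewrite -[RHS](@coord_change_id _ _ _ q q) //; exact: mem_dom. Qed.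

(** * Curves in a manifold and curves of zero velocity *)

Section Curves.
Variables (R : realType) (n : nat) (Q : manifold R n).

Lemma mdiff_precomp (V W : normedModType R) (g dg : W -> V) (f : V -> Q) x :
  mdifferentiable f (g x) -> is_diff x g dg ->
  mdifferentiable (f \o g) x /\ mdiff (f \o g) x =1 mdiff f (g x) \o dg.
Proof.
move=> [cf df] hg.
have dfg := is_diff_comp hg (differentiableP df).
split; last exact: is_diffE dfg.
split; last exact: is_diff_differentiable dfg.
apply: continuous_comp => //.
exact: differentiable_continuous (is_diff_differentiable hg).
Qed.

Lemma near_eq_mdiff (V : normedModType R) (f g : V -> Q) x :
  {near x, f =1 g} -> mdifferentiable f x ->
  mdifferentiable g x /\ mdiff g x =1 mdiff f x.
Proof.
move=> fg [cf df]; have fgx := nbhs_singleton fg.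
have dg : is_diff x (chart (g x) \o g) ('d (chart (f x) \o f) x).
  apply: (near_eq_is_diff _ (differentiableP df)).
  by apply: (filterS _ fg) => y /= ->; rewrite fgx.
split; last exact: is_diffE dg.
split; last exact: is_diff_differentiable dg.
move=> A /=; rewrite -fgx => /cf fA.
have nA : nbhs x (fun y => A (f y)) := fA.
suff : nbhs x (fun y => A (g y)) by [].
by apply: (filterS _ (filterI fg nA)) => y [/= ->].
Qed.

Lemma is_derive0_locally_cst (f : R -> R) (c d : R) :
  (forall x, ball c d x -> is_derive x 1 f 0) ->
  forall x, ball c d x -> f x = f c.
Proof.
move=> df x cx.
(* The closed interval of radius [|x - c|] around [c] lies in the open ball, so the mean value
   theorem applies on either side of [c]. *)
have sub y a b : a \in `[c - `|x - c|, c + `|x - c|] ->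
    b \in `[c - `|x - c|, c + `|x - c|] -> y \in `[a, b] -> ball c d y.
  rewrite !in_itv /= => /andP[a1 _] /andP[_ b1] /andP[ya yb].
  move: cx; rewrite -ball_normE /ball_ /= distrC; apply: le_lt_trans.
  rewrite [`|c - y|]distrC ler_distl; apply/andP; split.
    exact: le_trans a1 ya.
  exact: le_trans yb b1.
have xin : x \in `[c - `|x - c|, c + `|x - c|].
  by rewrite in_itv /= -ler_distl.
have cin : c \in `[c - `|x - c|, c + `|x - c|].
  by rewrite in_itv /= -ler_distl subrr normr0.
have cst_le a b : a \in `[c - `|x - c|, c + `|x - c|] ->
    b \in `[c - `|x - c|, c + `|x - c|] -> a <= b -> f b = f a.
  move=> ha hb ab; apply/eqP; rewrite -subr_eq0; apply/eqP.
  have dab y : y \in `[a, b] -> is_derive y 1 f 0.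
    by move=> yab; apply/df/(sub _ _ _ ha hb).
  have dab' y : y \in `]a, b[ -> is_derive y 1 f (cst 0 y).
    move=> yab; apply: dab; move: yab.
    by rewrite !in_itv /= => /andP[/ltW -> /ltW ->].
  have cab : {within `[a, b], continuous f}.
    by apply: derivable_within_continuous => y /dab.
  by have [y _ ->] := MVT_segment ab dab' cab; rewrite mul0r.
by have [xc|/ltW cx'] := leP x c; [apply/esym|]; exact: cst_le.
Qed.

(** The components of [e] in a fixed chart have derivative 0, so [e] is locally constant; as the
    line is connected, it is constant. *)
Lemma velocity0_cst (e : R -> Q) :
  (forall t, mdifferentiable e t) -> (forall t, velocity e t = 0) ->
  forall s t, e s = e t.
Proof.
move=> de ve.
(* A linear map on the line that vanishes at 1 is zero. *)
have me t h : mdiff e t h = 0.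
  rewrite -[h]mulr1 /mdiff; have := ve t; rewrite velocityE // /mdiff => E.
  by rewrite -[h * 1]/(h *: (1 : R)) linearZZ E scaler0.
have loc t0 : \forall t \near t0, e t = e t0.
  have /nbhs_ballP[d /= d0 dP] : nbhs t0 (fun t => dom (e t0) (e t)).
    exact: (de t0).1 _ (near_dom (mem_dom (e t0))).
  apply/nbhs_ballP; exists d => //= t t0t.
  have dk s : ball t0 d s -> is_diff s (chart (e t0) \o e) (cst 0).
    move=> /dP es; have := mdifferentiable_chart (de s) es.
    move=> [dd E]; apply: DiffDef; first exact: dd.
    rewrite E; apply/funext => h /=.
    by rewrite me /coord_change linear0.
  have dkj s (j : 'I_n) : ball t0 d s ->
      is_derive s 1 (fun s => chart (e t0) (e s) 0 j) 0.
    move=> /dk ks.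
    have dks : derivable (chart (e t0) \o e) s 1.
      exact: diff_derivable (is_diff_differentiable ks).
    apply: DeriveDef; first exact: (derivable_mxP _ _ _).1 dks 0 j.
    rewrite -(derive_coord j dks) deriveE; last exact: is_diff_differentiable ks.
    by rewrite (is_diffE ks) mxE.
  have : chart (e t0) (e t) = chart (e t0) (e t0).
    by apply/rowP => j; apply: (is_derive0_locally_cst (dkj ^~ j)).
  move=> /(congr1 (chart_inv (e t0))); rewrite chartKp chartK //.
  exact: dP.
(* The indicator of [e x = e s] is locally constant: its derivative is 0. *)
move=> s t; pose chi (x : R) : R := (asbool (e x = e s))%:R.
have dchi (x : R) : is_derive x (1 : R) chi 0.
  apply: (@near_eq_is_derive _ _ _ (cst (chi x))).
  by apply: (filterS _ (loc x)) => y exy; rewrite /chi /= exy.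
have := is_derive_0_is_cst s t dchi; rewrite /chi asboolT //.
by case: asboolP => // _ /eqP; rewrite oner_eq0.
Qed.

End Curves.

(** * Time-dependent maps: time and space derivatives *)

Section TimeMaps.
Variables (R : realType) (m n : nat) (U : manifold R m) (Q : manifold R n).
Variable (F : R -> U -> Q).
Hypothesis F_smooth : smooth_time_map F.

(** As a map on a single normed space, it has one differential from which both the velocity in time
    and the tangent map in space are read off. *)
Definition joint (u : U) (z : R * 'rV[R]_m) : Q := F z.1 (chart_inv u z.2).

Lemma joint_mdifferentiable u t x : img u x -> mdifferentiable (joint u) (t, x).
Proof. by move=> ux; exact: (smooth_into_mdifferentiable (F_smooth u)). Qed.

Lemma joint_curve_at u t x : img u x ->
  mdifferentiable (F ^~ (chart_inv u x)) t /\
  velocity (F ^~ (chart_inv u x)) t = mdiff (joint u) (t, x) (1, 0).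
Proof.
move=> ux.
have [dF E] := mdiff_precomp (joint_mdifferentiable t ux) (is_diff_pairl t x).
by split; [exact: dF|rewrite velocityE //; exact: E].
Qed.

Lemma joint_curve u t : mdifferentiable (F ^~ u) t /\
  velocity (F ^~ u) t = mdiff (joint u) (t, chart u u) (1, 0).
Proof. by have := joint_curve_at t (img_chartp u); rewrite chartKp. Qed.

Lemma joint_open u p : open [set z | img u z.2 /\ dom p (joint u z)].
Proof.
apply: smooth_into_open (F_smooth u).
apply: (@open_comp _ _ snd (img u)) => [z _|]; first exact: cvg_snd.
exact: open_img.
Qed.

Lemma joint_slice u t : mapdiff (F t) u /\
  forall w : tangent u,
    tangent_map (F t) u w = mdiff (joint u) (t, chart u u) (0, w).
Proof.
have [dF E] := mdiff_precomp (joint_mdifferentiable t (img_chartp u))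
  (is_diff_pairr t (chart u u)).
split; first by apply/mapdiffE.
by move=> w; rewrite tangent_mapE; exact: E.
Qed.

(** Linearity of the differential at [(a, w) = a (1, 0) + (0, w)]. It serves to differentiate curves
    in which time and point vary together. *)
Lemma mdiff_joint u t a w : mdiff (joint u) (t, chart u u) (a, w) =
  a *: velocity (F ^~ u) t + tangent_map (F t) u w.
Proof.
rewrite (joint_curve u t).2 (joint_slice u t).2 /mdiff -linearZZ -linearD.
suff -> : (a, w) = a *: ((1, 0) : R * 'rV[R]_m) + (0, w) by [].
by apply/pair_equal_spec; rewrite /= scaler0 add0r addr0 [a *: _]mulr1.
Qed.

End TimeMaps.

(** * Flows and uniqueness of integral curves *)

Section Flow.
Variables (R : realType) (n : nat) (Q : manifold R n).
Variables (X : forall q : Q, tangent q) (Phi : R -> Q -> Q).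
Hypothesis flowX : is_global_flow X Phi.

Let Phi_smooth : smooth_time_map Phi. Proof. by case: flowX. Qed.
Let Phi0 q : Phi 0 q = q. Proof. by case: flowX. Qed.
Let PhiD s t q : Phi (s + t) q = Phi s (Phi t q). Proof. by case: flowX. Qed.
Let Phi_vel t q : velocity (Phi ^~ q) t = X (Phi t q).
Proof. by case: flowX. Qed.

(** Differentiate Phi_t(Phi_s(q)) = Phi_s(Phi_t(q)) in s at s = 0. *)
Lemma flow_invariant_field t q : tangent_map (Phi t) q (X q) = X (Phi t q).
Proof.
have [dc vc] := joint_curve Phi_smooth q 0.
have [dF _] := joint_slice Phi_smooth q t.
have := @mdiff_comp _ _ _ _ _ _ (Phi ^~ q) (Phi t) 0 dc.
rewrite Phi0 => /(_ dF) [dFc /(_ 1)] /=; rewrite -!velocityE //.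
rewrite Phi_vel Phi0 => <-.
have -> : Phi t \o Phi ^~ q = Phi ^~ (Phi t q).
  by apply/funext => s /=; rewrite -!PhiD addrC.
by rewrite Phi_vel Phi0.
Qed.

(* No Lipschitz estimate is needed, as a global flow Phi is given: by
   Phi_s' X = X, the curve t |-> Phi (- t) (c t) has zero velocity. *)
Theorem integral_curve_unique (c : R -> Q) :
  (forall t, mdifferentiable c t) -> (forall t, velocity c t = X (c t)) ->
  forall t, c t = Phi t (c 0).
Proof.
move=> dc vc.
suff e_cst t : Phi (- t) (c t) = c 0.
  by move=> t; rewrite -(e_cst t) -PhiD subrr Phi0.
pose e t := Phi (- t) (c t).
suff de s : mdifferentiable e s /\ velocity e s = 0.
  have := velocity0_cst (fun s => (de s).1) (fun s => (de s).2) t 0.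
  by rewrite /e oppr0 Phi0.
(* Near [s], the curve [e] is [joint Phi u \o g], with [c] read in the chart at [u = c s]. *)
pose u := c s; pose g t := (- t, chart u (c t)).
have dg : is_diff s g (fun h => (- h, mdiff c s h)).
  apply: is_diff_pair; apply: differentiableP; exact: (dc s).2.
have dj := joint_mdifferentiable Phi_smooth (- s) (img_chartp u).
have [de' E] := @mdiff_precomp _ _ _ _ _ g _ (joint Phi u) s dj dg.
have [||de Ee] := near_eq_mdiff (f := joint Phi u \o g) (g := e) (x := s).
- have nd : nbhs s (fun t => dom u (c t)).
    exact: (dc s).1 _ (near_dom (mem_dom u)).
  by apply: (filterS _ nd) => y uy; rewrite /joint /e /= chartK.
- exact: de'.
split => //; rewrite velocityE // Ee E /= mdiff_joint //.
(* The time part contributes [- X (e s)], and the space part is the image of [X (c s)] under the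
   tangent map of [Phi (- s)], which is [X (e s)]. *)
rewrite -velocityE // vc Phi_vel -/u flow_invariant_field.
by rewrite scaleN1r addNr.
Qed.

(** Applied at time [- t], this gives the smooth inverses needed to see a flow as a time-dependent
    diffeomorphism. *)
Lemma flow_slice_smooth t : smooth_map (Phi t).
Proof.
move=> u; split=> [x ux|p k].
  apply: (@continuous_comp _ _ _ (fun x => (t, x)) (joint Phi u)); last first.
    exact: (joint_mdifferentiable Phi_smooth t ux).1.
  exact: differentiable_continuous (is_diff_differentiable (is_diff_pairr t x)).
exact (@Ck_on_slice _ _ _ k _ _ t (@joint_open _ _ _ _ _ _ Phi_smooth u p)
  ((Phi_smooth u).2 p k)).
Qed.

End Flow.

(** * The lift of a flow to the tangent bundle *)

Section FlowLift.
Variables (R : realType) (n : nat) (Q : manifold R n).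
Variables (Y : vector_field Q) (Phi : R -> Q -> Q).
Hypothesis flowY : is_global_flow Y Phi.

Let Phi_smooth : smooth_time_map Phi. Proof. by case: flowY. Qed.
Let Phi0 q : Phi 0 q = q. Proof. by case: flowY. Qed.
Let Phi_vel t q : velocity (Phi ^~ q) t = Y (Phi t q).
Proof. by case: flowY. Qed.

(** The flow in coordinates, with the chart at [q] in both source and target; it is meaningful as
    long as the flow stays in [dom q]. *)
Let G (q : Q) : R * 'rV[R]_n -> 'rV[R]_n := chart q \o joint Phi q.

Lemma flow_chart_differentiable q s x :
  img q x -> dom q (Phi s (chart_inv q x)) -> differentiable (G q) (s, x).
Proof.
move=> qx sx; apply: is_diff_differentiable.
exact: mdifferentiable_chart (joint_mdifferentiable Phi_smooth s qx) sx.
Qed.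

(** The flow has velocity [Y] at time 0. Writing [Y] as a time derivative of [G] turns the
    derivatives of [Y] into mixed derivatives of [G]. *)
Lemma field_in_chart_flow q x : img q x ->
  field_in_chart q Y x = 'D_((1, 0) : R * 'rV[R]_n) (G q) (0, x).
Proof.
move=> qx; have qx' : dom q (joint Phi q (0, x)).
  by rewrite /joint Phi0; exact: dom_chart_inv.
rewrite deriveE; last exact: flow_chart_differentiable.
have dj := joint_mdifferentiable Phi_smooth 0 qx.
rewrite (is_diffE (mdifferentiable_chart dj qx')).
rewrite /= -(joint_curve_at Phi_smooth 0 qx).2 Phi_vel.
by rewrite /joint /= Phi0.
Qed.

(** The space derivative of [G] gives components in the chart at [q], whereas the tangent map has
    values in the preferred chart at [Phi s q]; hence the change of coordinates. *)
Lemma tangent_flow_chart q s (v : tangent q) : dom q (Phi s q) ->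
  coord_change q (Phi s q) (Phi s q)
    ('D_((0, v) : R * 'rV[R]_n) (G q) (s, chart q q)) =
  tangent_map (Phi s) q v.
Proof.
move=> qs; have qx := img_chartp q.
have jE : joint Phi q (s, chart q q) = Phi s q by rewrite /joint /= chartKp.
rewrite deriveE; last by apply: flow_chart_differentiable; rewrite ?chartKp.
rewrite (joint_slice Phi_smooth q s).2 /mdiff.
have := @diff_chart_change _ _ _ _ _ _ q (Phi s q)
  (joint_mdifferentiable Phi_smooth s qx).
by rewrite jE => /(_ qs (mem_dom _) (0, v)).
Qed.

(** Chain rule along the lifted curve in the bundle chart at [q]. Its base velocity at time 0 is
    [Y], and its fibre velocity is the time derivative of ['D_(0, v) G], equal to ['D_v] of [Y] in
    the chart by symmetry of second derivatives. *)
Lemma flow_lift_derive (L : forall q : Q, tangent q -> R) (q : Q)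
    (v : tangent q) :
  differentiable (fun_in_chart L q) (chart q q, v) ->
  is_derive (0 : R) (1 : R)
    (fun s => L (Phi s q) (tangent_map (Phi s) q v))
    (tangent_lift_deriv L Y v).
Proof.
move=> dL; pose x0 := chart q q; have qx := img_chartp q.
pose O := [set z : R * 'rV[R]_n | img q z.2 /\ dom q (joint Phi q z)].
have oO : open O by exact: joint_open.
have O0 : O (0, x0) by split => //; rewrite /joint /= Phi0 chartKp; exact: mem_dom.
have GC k : Ck_on k O (G q) := (Phi_smooth q).2 q k.
pose DG (z : R * 'rV[R]_n) := 'D_((0, v) : R * 'rV[R]_n) (G q) z.
have dDG : differentiable DG (0, x0) by exact: ((GC 2%N).2 (0, v)).1.
have dG : differentiable (G q) (0, x0) by exact: (GC 1%N).1.
have G0 : G q (0, x0) = x0 by rewrite /G /= /joint /= Phi0 chartKp.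
have q0 : dom q (Phi 0 q) by rewrite Phi0; exact: mem_dom.
have DG0 : DG (0, x0) = v.
  have := tangent_flow_chart v q0; rewrite Phi0 coord_change_id; last exact: mem_dom.
  move=> E; apply: etrans E _.
  by have -> : Phi 0 = id by [apply/funext => q'; exact: Phi0]; exact: tangent_map_id.
(* The chart components of the point [Phi s q] and of the image of [v] there. *)
pose c (s : R) := (G q (s, x0), DG (s, x0)).
have dc : is_diff (0 : R) c
    (fun h => ('d (G q) (0, x0) (h, 0), 'd DG (0, x0) (h, 0))).
  have il := is_diff_pairl (0 : R) x0.
  apply: is_diff_pair.
    exact: is_diff_comp il (differentiableP dG).
  exact: is_diff_comp il (differentiableP dDG).
have c0 : c 0 = (x0, v) by rewrite /c G0 DG0.
have dLc : differentiable (fun_in_chart L q) (c 0) by rewrite c0.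
have dLcomp := is_diff_comp dc (differentiableP dLc).
(* The bundle chart at [q] describes the lifted curve only while [Phi s q] lies in [dom q], that is,
   for small [s]. *)
apply: (@near_eq_is_derive _ _ _ (fun_in_chart L q \o c)).
  have nd : nbhs (0 : R) (fun s => dom q (Phi s q)).
    exact: (joint_curve Phi_smooth q 0).1.1 _ (near_dom q0).
  apply: (filterS _ nd) => s qs; rewrite /c /fun_in_chart /=.
  have -> : chart_inv q (G q (s, x0)) = Phi s q.
    by rewrite /G /joint /= chartKp chartK.
  by congr (L _ _); exact: tangent_flow_chart.
have dd := is_diff_differentiable dLcomp.
apply: DeriveDef; first exact: diff_derivable.
rewrite deriveE // (is_diffE dLcomp) /= c0 /tangent_lift_deriv deriveE //.
congr ('d _ _ _); apply/pair_equal_spec; split.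
  by rewrite field_in_chart_flow // deriveE.
rewrite -[LHS]deriveE // (Schwarz_rV _ _ oO O0 (GC 2%N)) -derive_slice.
apply: near_eq_derive; apply: (filterS _ (near_img qx)) => x qx'.
by rewrite field_in_chart_flow.
Qed.

End FlowLift.

(** * The Lagrangian, its momentum and its differentiability *)

Section Lagrangian.
Variables (R : realType) (n : nat) (Q : manifold R n).
Variables (g : riemannian_metric Q) (b : one_form Q) (V : Q -> R).

Lemma metricDr (q : Q) (a : R) (u v w : tangent q) :
  g q u (a *: v + w) = a * g q u v + g q u w.
Proof. exact: metric_linear. Qed.

Lemma metricDl (q : Q) (a : R) (u v w : tangent q) :
  g q (a *: v + w) u = a * g q v u + g q w u.
Proof. by rewrite !(Defs.metric_sym _ _ u) metricDr. Qed.

Lemma one_formDr (q : Q) (a : R) (v w : tangent q) :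
  b q (a *: v + w) = a * b q v + b q w.
Proof. exact: form_linear. Qed.

(** L(v + h w) is quadratic in h, with linear coefficient g(v, w) + b(w). *)
Lemma momentum_lagrangian (q : Q) (v w : tangent q) :
  momentum (lagrangian g b V) v w = g q v w + b q w.
Proof.
apply: (@derive_quadratic _ _ _ _ _ _ (2^-1 * g q w w)) => h.
rewrite /lagrangian metricDl !metricDr one_formDr (Defs.metric_sym g w v); lra.
Qed.

Lemma scalar_sum (f : 'rV[R]_n -> R) (v : 'rV[R]_n) : scalar f ->
  f v = \sum_(i < n) v 0 i * f ('e_i).
Proof.
move=> linf.
pose fL : {scalar 'rV[R]_n} := HB.pack f (GRing.isLinear.Build _ _ _ _ _ linf).
rewrite {1}[v]row_sum_delta -[f]/(fL : _ -> _) linear_sum.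
by apply: eq_bigr => i _; rewrite linearZ.
Qed.

(** In a bundle chart [L] is a polynomial in the fibre components whose coefficients depend on the
    base point only; these are the functions whose smoothness is assumed for [g], [b] and [V]. *)
Lemma fun_in_chart_lagrangian (p : Q) (z : 'rV[R]_n * 'rV[R]_n) :
  let q := chart_inv p z.1 in
  fun_in_chart (lagrangian g b V) p z =
  2^-1 * (\sum_(i < n) \sum_(j < n) (z.2 0 i * (z.2 0 j *
     g q (coord_change p q q ('e_i)) (coord_change p q q ('e_j)))))
  + \sum_(j < n) (z.2 0 j * b q (coord_change p q q ('e_j)))
  - V q.
Proof.
move=> q; rewrite /fun_in_chart /lagrangian -/q; congr (_ * _ + _ - _).
  rewrite (scalar_sum (f := fun u => g q (coord_change p q q u) _)); last first.
    by move=> a u w; rewrite coord_change_linear metricDl.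
  apply: eq_bigr => i _; rewrite -mulr_sumr; congr (_ * _).
  apply: (scalar_sum (f := fun u => g q _ (coord_change p q q u))) => a u w.
  by rewrite coord_change_linear metricDr.
apply: (scalar_sum (f := fun u => b q (coord_change p q q u))) => a u w.
by rewrite coord_change_linear one_formDr.
Qed.

Lemma fun_in_chart_differentiable (hV : smooth_fun V) (q : Q) (v : tangent q) :
  differentiable (fun_in_chart (lagrangian g b V) q) (chart q q, v).
Proof.
have qx := img_chartp q.
have d1 : differentiable (fst : 'rV[R]_n * 'rV[R]_n -> 'rV[R]_n) (chart q q, v).
  by apply: linear_differentiable => z; exact: cvg_fst.
have d2 : differentiable (snd : 'rV[R]_n * 'rV[R]_n -> 'rV[R]_n) (chart q q, v).
  by apply: linear_differentiable => z; exact: cvg_snd.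
have dfst (f : 'rV[R]_n -> R) : differentiable f (chart q q) ->
    differentiable (fun z : 'rV[R]_n * 'rV[R]_n => f z.1) (chart q q, v).
  exact: (differentiable_comp d1).
have dsnd (j : 'I_n) : differentiable
    (fun z : 'rV[R]_n * 'rV[R]_n => z.2 0 j) (chart q q, v).
  exact: (differentiable_comp d2 (differentiable_coord _ 0 j)).
have dsum (f : 'I_n -> 'rV[R]_n * 'rV[R]_n -> R) :
    (forall i, differentiable (f i) (chart q q, v)) ->
    differentiable (fun z => \sum_(i < n) f i z) (chart q q, v).
  move=> df; rewrite (_ : (fun z => _) = \sum_(i < n) f i).
    exact: differentiable_sum.
  by apply/funext => z; rewrite fct_sumE.
have dM (f h : 'rV[R]_n * 'rV[R]_n -> R) :
    differentiable f (chart q q, v) -> differentiable h (chart q q, v) ->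
    differentiable (fun z => f z * h z) (chart q q, v).
  exact: differentiableM.
rewrite (funext (fun_in_chart_lagrangian q)).
apply: differentiableB.
  apply: differentiableD.
    apply: (dM (cst 2^-1)); first exact: differentiable_cst.
    apply: (dsum _) => i; apply: (dsum _) => j; apply: (dM _ _); first exact: dsnd.
    apply: (dM _ _); first exact: dsnd.
    apply: (dfst (fun x => let q' := chart_inv q x in g q'
      (coord_change q q' q' 'e_i) (coord_change q q' q' 'e_j))).
    exact: (metric_smooth g q 'e_i 'e_j 1%N).1.
  apply: (dsum _) => j; apply: (dM _ _); first exact: dsnd.
  apply: (dfst (fun x => let q' := chart_inv q x in b q'
    (coord_change q q' q' 'e_j))).
  exact: (form_smooth b q 'e_j 1%N).1.
by apply: (dfst (V \o chart_inv q)); exact: (hV q 1%N).1.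
Qed.

End Lagrangian.

(** * Energy and constraints transformed by a time-dependent diffeomorphism *)

Lemma tangent_map_cancel (R : realType) (m n : nat) (U : manifold R m)
    (Q : manifold R n) (F : U -> Q) (G : Q -> U) (u : U)
    (w : tangent u) :
  cancel F G -> mapdiff F u -> mapdiff G (F u) ->
  tangent_map G (F u) (tangent_map F u w) = w.
Proof.
move=> FK dF dG; have [_ E] := tangent_map_comp dF dG.
apply: etrans (esym (E w)) _.
by have -> : G \o F = id by [apply/funext]; exact: tangent_map_id.
Qed.

Lemma tangent_mapD (R : realType) (m n : nat) (U : manifold R m)
    (Q : manifold R n) (F : U -> Q) (u : U) (v w : tangent u) :
  tangent_map F u (v + w) = tangent_map F u v + tangent_map F u w.
Proof. by rewrite /tangent_map linearD. Qed.

Lemma smooth_fieldB (R : realType) (n : nat) (Q : manifold R n)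
    (X Y : forall q : Q, tangent q) :
  smooth_field X -> smooth_field Y -> smooth_field (fun q => X q - Y q).
Proof.
move=> sX sY p k.
have -> : field_in_chart p (fun q => X q - Y q) =
    (fun x => field_in_chart p X x - field_in_chart p Y x).
  by apply/funext => x; rewrite /field_in_chart /coord_change linearB.
apply: Ck_onB; [|exact: sX|exact: sY].
rewrite (_ : [set x | _] = img p); first exact: open_img.
by apply/seteqP; split => [x []|x px].
Qed.

Section TimeDependentDiffeo.
Variables (R : realType) (m n : nat) (U : manifold R m) (Q : manifold R n).
Variable C : time_dep_diffeo U Q.

Lemma tdd_mapdiff t u : mapdiff (C t) u.
Proof. exact: (joint_slice (tdd_smooth C) u t).1. Qed.

Lemma tdd_inv_mapdiff t q : mapdiff (tdd_inv C t) q.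
Proof. exact: smooth_map_mapdiff (tdd_inv_smooth C t). Qed.

Lemma tdd_tangentK t u (w : tangent u) :
  tangent_map (tdd_inv C t) (C t u) (tangent_map (C t) u w) = w.
Proof.
apply: tangent_map_cancel; first exact: tddK.
  exact: tdd_mapdiff.
exact: tdd_inv_mapdiff.
Qed.

Lemma tdd_tangent_invK t q (v : tangent q) :
  tangent_map (C t) (tdd_inv C t q) (tangent_map (tdd_inv C t) q v) = v.
Proof.
apply: tangent_map_cancel; first exact: tdd_invK.
  exact: tdd_inv_mapdiff.
exact: tdd_mapdiff.
Qed.

Lemma tdd_tangent_map_invK t u (v : tangent (C t u)) :
  tangent_map (C t) u (tangent_map (tdd_inv C t) (C t u) v) = v.
Proof. by have := tdd_tangent_invK t v; rewrite tddK. Qed.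

Lemma tdd_curve_mdifferentiable t u : mdifferentiable (fun s => C s u) t.
Proof. exact: (joint_curve (tdd_smooth C) u t).1. Qed.

Variables (g : riemannian_metric Q) (b : one_form Q) (V : Q -> R).
Let L := lagrangian g b V.

(** The fibre derivative of the transformed Lagrangian along a vector is the momentum of [L] along
    its image under C_t'. The vector inserted by the push-forward has image [v - tdd_dot C t u]. *)
Lemma pushed_energy_lagrangian t u (v : tangent (C t u)) :
  pushed_energy L C t v =
  momentum L v (v - tdd_dot C t u) - L v.
Proof.
rewrite /pushed_energy /energy /momentum.
rewrite (@derive_affine _ _ _ _ (@L (C t (tdd_inv C t (C t u))))); last first.
  exact: tangent_map_linear.
rewrite /transformed_lagrangian tdd_tangent_invK subrK.
by rewrite !tddK.
Qed.

Lemma energy_along_pushed (Y : vector_field Q) :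
  (forall t (q : Q) (v : tangent q),
     energy_along L Y v = pushed_energy L C t v) <->
  (forall t u, tdd_dot C t u = Y (C t u)).
Proof.
have dB (q : Q) (v w d : tangent q) :
    momentum L v (w - d) = momentum L v w - momentum L v d.
  by rewrite -scaleN1r addrC !momentum_lagrangian metricDr one_formDr; ring.
split=> [E t u|E t q v]; last first.
  rewrite -(tdd_invK C t q) in v *.
  by rewrite pushed_energy_lagrangian E dB /energy_along /energy; ring.
pose d : tangent (C t u) := tdd_dot C t u - Y (C t u).
have d0 (v : tangent (C t u)) : g (C t u) v d + b (C t u) d = 0.
  have := E t _ v; rewrite pushed_energy_lagrangian dB /energy_along /energy.
  by rewrite -(momentum_lagrangian g b V) -/L dB; lra.
(* Take v = 0 in [d0]; below, v = d leaves g(d, d) = 0, so d = 0 by positivity. *)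
have bd : b (C t u) d = 0.
  have g0 := metricDl g (-1) d d d.
  by have := d0 0; rewrite scaleN1r addNr in g0; rewrite g0 => ?; lra.
apply/eqP; rewrite -subr_eq0 -/d; apply: contraT => /(metric_gt0 g).
by have := d0 d; rewrite bd addr0 => ->; rewrite ltxx.
Qed.

Variables (r : nat) (Z : vector_field Q) (D : smooth_distribution Q r).

(** The shift Z - dC_t/dt = Z - Y lies in D, so D absorbs it and the affine condition becomes
    linear. *)
Lemma transformed_constraintE (Y : vector_field Q) t u :
  tdd_dot C t u = Y (C t u) -> Y (C t u) - Z (C t u) \in D (C t u) ->
  transformed_constraint Z D C t u =
  [set w | tangent_map (C t) u w \in D (C t u)].
Proof.
move=> E YZ; rewrite /transformed_constraint E; apply/seteqP; split=> w /=.
  move=> [d dD ->]; rewrite -addrA -opprB; exact: rpredB.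
move=> wD; exists (tangent_map (C t) u w + (Y (C t u) - Z (C t u))).
  exact: rpredD.
by rewrite addrA subrK addrK.
Qed.

End TimeDependentDiffeo.

(** * The flow of a vector field as a time-dependent diffeomorphism *)

Section FlowDiffeo.
Variables (R : realType) (n : nat) (Q : manifold R n) (Y : vector_field Q).

Lemma flowP : is_global_flow Y (flow Y).
Proof. by rewrite /flow; case: cid. Qed.

Lemma flow0 q : flow Y 0 q = q.
Proof. by case: flowP. Qed.

Lemma flowD s t q : flow Y (s + t) q = flow Y s (flow Y t q).
Proof. by case: flowP. Qed.

Lemma flowK t : cancel (flow Y t) (flow Y (- t)).
Proof. by move=> q; rewrite -flowD addNr flow0. Qed.

Lemma flowNK t : cancel (flow Y (- t)) (flow Y t).
Proof. by move=> q; rewrite -flowD subrr flow0. Qed.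

Lemma flow_smooth : smooth_time_map (flow Y).
Proof. by case: flowP. Qed.

Lemma flow_mapdiff t q : mapdiff (flow Y t) q.
Proof. exact: (joint_slice flow_smooth q t).1. Qed.

Definition flow_diffeo : time_dep_diffeo Q Q := TimeDepDiffeo flow_smooth
  (fun t => flow_slice_smooth flowP (- t)) flowK flowNK.

Lemma tangent_flow0 q (v : tangent q) : tangent_map (flow Y 0) q v = v.
Proof.
have -> : flow Y 0 = id by apply/funext => q'; exact: flow0.
exact: tangent_map_id.
Qed.

Lemma tangent_flowD s t q (v : tangent q) : tangent_map (flow Y (s + t)) q v =
  tangent_map (flow Y s) (flow Y t q) (tangent_map (flow Y t) q v).
Proof.
have -> : flow Y (s + t) = flow Y s \o flow Y t.
  by apply/funext => q'; exact: flowD.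
exact: (tangent_map_comp (flow_mapdiff t q) (flow_mapdiff s _)).2.
Qed.

(** [Y^TQ(L)] is the derivative at time 0 of [L] along the lifted flow. By the group law, the
    derivative at time s is the one at time 0 from the point transported by s, so if [Y^TQ(L)]
    vanishes everywhere, [L] is constant along lifted curves. *)
Lemma lift_deriv0_iff (L : forall q : Q, tangent q -> R) :
  (forall (q : Q) (v : tangent q),
     differentiable (fun_in_chart L q) (chart q q, v)) ->
  (forall (q : Q) (v : tangent q), tangent_lift_deriv L Y v = 0) <->
  (forall (q : Q) (v : tangent q) t,
     L (flow Y t q) (tangent_map (flow Y t) q v) = L q v).
Proof.
move=> dL; split=> [L0 q v t|Lc q v]; last first.
  have [_ <-] := flow_lift_derive flowP (dL q v).
  by under eq_fun do rewrite Lc; exact: derive_cst.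
pose k s := L (flow Y s q) (tangent_map (flow Y s) q v).
have k0 : k 0 = L q v by rewrite /k tangent_flow0 flow0.
rewrite -k0 -/(k t); apply: is_derive_0_is_cst => s.
have ks := flow_lift_derive flowP (dL _ (tangent_map (flow Y s) q v)).
rewrite L0 in ks.
have -> : k = (fun h => L (flow Y h (flow Y s q))
    (tangent_map (flow Y h) (flow Y s q) (tangent_map (flow Y s) q v))) \o
    (fun h => h - s).
  by apply/funext => h /=; rewrite -tangent_flowD -flowD subrK.
have ds : is_derive s (1 : R) (fun h => h - s) 1.
  by rewrite -[X in is_derive _ _ _ X]subr0; exact: is_deriveB.
have ks' : is_derive ((fun h => h - s) s) (1 : R) (fun h =>
    L (flow Y h (flow Y s q))
    (tangent_map (flow Y h) (flow Y s q) (tangent_map (flow Y s) q v))) 0.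
  by rewrite subrr.
by have := @is_derive1_comp _ _ (fun h => h - s) _ _ _ ks' ds; rewrite mul0r.
Qed.

End FlowDiffeo.

Theorem proposition8 (R : realType) (n r : nat) (hr : (1 < r)%N)
    (hrn : (r < n)%N) (Q : manifold R n)
    (g : riemannian_metric Q) (b : one_form Q)
    (V : Q -> R) (hV : smooth_fun V)
    (Z : vector_field Q) (D : smooth_distribution Q r) (hD : ~ integrable_distribution D)
    (f : constraint_manifold Z D -> R)
    (hf : moving_energy (lagrangian g b V) f) :
  kinematically_interpretable (lagrangian g b V) f <->
  exists Y : vector_field Q,
    [/\ is_generator (lagrangian g b V) f Y,
        is_section D (fun q => Y q - Z q),
        invariant_under D Y &
        forall (q : Q) (v : tangent q),
          tangent_lift_deriv (lagrangian g b V) Y v = 0].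
Proof.
have dL (q : Q) (v : tangent q) := fun_in_chart_differentiable g b hV v.
split=> [[Y [genY [m [U [C [hE D1 D2 D3]]]]]]|[Y [genY [_ P1] P2 P3]]].
  exists Y.
  have Cdot := (energy_along_pushed C g b V Y).1 hE.
  have CE t u : C t u = flow Y t (C 0 u).
    apply: (integral_curve_unique (flowP Y) (c := fun s => C s u)).
      by move=> s; exact: tdd_curve_mdifferentiable.
    by move=> s; exact: Cdot.
  have tCE t u w : tangent_map (C t) u w =
      tangent_map (flow Y t) (C 0 u) (tangent_map (C 0) u w).
    have -> : C t = flow Y t \o C 0 by apply/funext => u'; exact: CE.
    exact: (tangent_map_comp (tdd_mapdiff C 0 u) (flow_mapdiff Y t _)).2.
  (* By (D1) the zero vector satisfies the transformed constraint: 0 = d + Z - Y with d in D. As C_0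
     is onto, this covers every point. *)
  have YZ q : Y q - Z q \in D q.
    rewrite -(tdd_invK C 0 q); set u := tdd_inv C 0 q.
    have [W WE] := D1 0 u.
    have : transformed_constraint Z D C 0 u 0 by rewrite WE /=; exact: rpred0.
    move=> [d dD]; rewrite /tangent_map linear0 Cdot => /esym/eqP.
    by rewrite subr_eq0 => /eqP <-; rewrite addrK.
  have cE t u := transformed_constraintE (Cdot t u) (YZ (C t u)).
  split => //.
  - by split => //; apply: smooth_fieldB; exact: vf_smooth.
  - move=> t q; rewrite -(tdd_invK C 0 q); set u := tdd_inv C 0 q.
    (* (D2) between the times t and 0; with C_t' = Phi_t' C_0' it yields both inclusions of (P2),
       after pulling vectors back to U. *)
    have D_C w : tangent_map (C t) u w \in D (C t u) <->
                 tangent_map (C 0) u w \in D (C 0 u).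
      have := D2 t 0 u; rewrite !cE => /seteqP[s1 s2].
      by split; [exact: s1|exact: s2].
    rewrite -CE; apply/seteqP; split=> w /=.
      move=> wD; pose w' : tangent u := tangent_map (tdd_inv C t) (C t u) w.
      have E : tangent_map (C t) u w' = w by exact: tdd_tangent_map_invK.
      exists (tangent_map (C 0) u w'); first by apply: (D_C w').1; rewrite E.
      by rewrite -tCE.
    move=> [v vD <-]; pose v' : tangent u := tangent_map (tdd_inv C 0) (C 0 u) v.
    have E : tangent_map (C 0) u v' = v by exact: tdd_tangent_map_invK.
    by rewrite -E -tCE; apply: (D_C v').2; rewrite E.
  - apply/(lift_deriv0_iff Y dL) => q v t.
    rewrite -(tdd_invK C 0 q) in v *; set u := tdd_inv C 0 q in v *.
    (* Chosen so that C_0' w + Y = v: the transformed Lagrangian at [w] is then L(v) at time 0 and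
       L(Phi_t' v) at time t. *)
    pose w : tangent u := tangent_map (tdd_inv C 0) (C 0 u) (v - Y (C 0 u)).
    have E : tangent_map (C 0) u w = v - Y (C 0 u).
      exact: tdd_tangent_map_invK.
    have := D3 t 0 u w.
    rewrite /transformed_lagrangian !Cdot tCE E subrK (CE t u).
    by rewrite -(flow_invariant_field (flowP Y)) -tangent_mapD subrK.
exists Y; split => //; exists n, Q, (flow_diffeo Y).
have Cdot t u : tdd_dot (flow_diffeo Y) t u = Y (flow_diffeo Y t u).
  by have [_ _ _] := flowP Y; exact.
(* By (P1) this set is the preimage of D under Phi_t', and by (P2) and injectivity of Phi_t' it is
   the fibre at [u], a linear space independent of t. *)
have cE t u : transformed_constraint Z D (flow_diffeo Y) t u = [set` D u].
  rewrite (transformed_constraintE (Cdot t u) (P1 _)).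
  apply/seteqP; split=> w /=; have /seteqP[s1 s2] := P2 t u.
    move=> /s1[w' w'D /(congr1 (tangent_map (tdd_inv (flow_diffeo Y) t) _))].
    by rewrite !(tdd_tangentK (flow_diffeo Y)) => <-.
  by move=> wD; apply: s2; exists w.
split.
- exact/energy_along_pushed.
- by move=> t u; exists (D u).
- by move=> s t u; rewrite !cE.
(* The right-hand side does not involve t, which is (D3). *)
- have LE t (u : Q) (w : tangent u) :
    transformed_lagrangian (lagrangian g b V) (flow_diffeo Y) t w =
    @lagrangian _ _ _ g b V u (w + Y u).
  rewrite /transformed_lagrangian Cdot /=.
  rewrite -(flow_invariant_field (flowP Y) t u) -tangent_mapD.
  exact: ((lift_deriv0_iff Y dL).1 P3).
by move=> s t u w; rewrite !LE.
Qed.
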